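(* Let $f:\mathbb{N}\to\mathbb{C}$ be an arithmetic function satisfying $$\sum_{q=1}^\infty \frac{|(f*\mathbf{1})(q)|}{q}\,\tau(q)<\infty.$$ Then its dual Ramanujan-Fourier series is pointwise convergent and $f(q)=\sum_{n=1}^\infty a(n)c_q(n)$ holds for every $q\in\mathbb{N}$, where $$a(n)=\sum_{m=1}^\infty \frac{(f*\mathbf{1})(nm)}{nm}\,\mu(m).$$
   Context: $\mathbb{N}=\{1,2,\dots\}$. $c_q(n)=\sum_{1\le k\le q,\,(k,q)=1}\exp(2\pi i kn/q)$ is the Ramanujan sum; $\mu$ is the Möbius function; $\tau(q)$ is the number of divisors of $q$; $\mathbf{1}(n)=1$; $*$ is Dirichlet convolution, $(f*\mathbf{1})(q)=\sum_{d\mid q}f(d)$. *)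

(* Defs.v *)
From HB Require Import structures.
From mathcomp Require Import all_boot all_order all_algebra.
From mathcomp Require Import all_classical all_reals all_analysis.
From mathcomp Require Import complex.
Set Implicit Arguments.
Unset Strict Implicit.
Unset Printing Implicit Defensive.

Import Order.TTheory GRing.Theory Num.Theory numFieldNormedType.Exports.

Local Open Scope ring_scope.
Local Open Scope complex_scope.

(* Arithmetic functions on {1, 2, ...} are encoded as functions on nat whose
   value at 0 is irrelevant: every sum below runs over positive integers. *)

(* Only meaningful for n > 0. *)
Definition moebius (n : nat) : int :=
  if has (fun p => p ^ 2 %| n)%N (primes n) then 0
  else (-1) ^+ size (primes n).

Definition tau (n : nat) : nat := size (divisors n).

Definition dirichlet_conv (K : pzRingType) (f g : nat -> K) (n : nat) : K :=
  \sum_(d <- divisors n) f d * g (n %/ d)%N.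

Definition arith_one (K : pzRingType) : nat -> K := fun=> 1.

(* exp (x + iy) = e^x (cos y + i sin y) *)
Definition Cexp (R : realType) (z : R[i]) : R[i] :=
  (expR (complex.Re z))%:C * (cos (complex.Im z) +i* sin (complex.Im z)).

Definition ramanujan_sum (R : realType) (q n : nat) : R[i] :=
  \sum_(1 <= k < q.+1 | coprime k q)
    Cexp (2%:R * (pi : R)%:C * 'i%C * (k * n)%:R / q%:R).

(* The type alias R[i]^o is how the library attaches to the field R[i] the
   topology of its modulus. *)
Definition partial_sums (R : realType) (u : nat -> R[i]) : nat -> R[i]^o :=
  fun N => \sum_(1 <= n < N.+1) u n.

Definition dual_RF_coef_term (R : realType) (f : nat -> R[i]) (n m : nat) :
    R[i] :=
  dirichlet_conv f (arith_one R[i]) (n * m)%N / (n * m)%:R * (moebius m)%:~R.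

Definition dual_RF_coef (R : realType) (f : nat -> R[i]) (n : nat) : R[i] :=
  limn (partial_sums (dual_RF_coef_term f n)).

(* Main.v *)
Require Import Defs.
From HB Require Import structures.
From mathcomp Require Import all_boot all_order all_algebra.
From mathcomp Require Import all_classical all_reals all_analysis.
From mathcomp Require Import complex.
Import Order.TTheory GRing.Theory Num.Theory numFieldNormedType.Exports.

Local Open Scope ring_scope.
Local Open Scope complex_scope.

(** Put [h k = (f * 1)(k) / k]. Exchanging the two summations turns
    [sum_n a(n) c_q(n)] into [sum_k h(k) (c_q * mu)(k)]. Since
    [c_q(n) = sum_(d | gcd(q, n)) mu(q/d) d], the convolution [(c_q * mu)(k)]
    equals [mu(q/k) k] when [k] divides [q] and [0] otherwise, so that Moebius
    inversion gives [f q]. The exchange is quantitative: truncating at [n <= N]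
    costs at most [q * sum_(k > N) |h k| tau(k)], because [|c_q| <= q] and each
    [k] is hit by at most [tau(k)] values of [n]. *)

(** * Finite sums over divisors and over multiples *)

(** The cutoff [N] is independent of [n]: a range common to all [n] is what allows nested divisor
    sums to be exchanged. *)
Lemma sum_divisors (V : nmodType) (F : nat -> V) (n N : nat) :
  (0 < n <= N)%N ->
  \sum_(d <- divisors n) F d = \sum_(1 <= d < N.+1 | (d %| n)%N) F d.
Proof.
case/andP=> n0 nN; rewrite -[RHS]big_filter; apply: perm_big.
apply: uniq_perm; rewrite ?filter_uniq ?iota_uniq ?divisors_uniq// => d.
rewrite -dvdn_divisors// mem_filter mem_index_iota ltnS.
case dn: (d %| n)%N => //=.
by rewrite (dvdn_gt0 n0 dn) (leq_trans (dvdn_leq n0 dn) nN).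
Qed.

Lemma sum_multiples (V : nmodType) (F : nat -> V) (n N : nat) : (0 < n)%N ->
  \sum_(1 <= k < N.+1 | (n %| k)%N) F k =
  \sum_(1 <= m < (N %/ n).+1) F (n * m)%N.
Proof.
move=> n0; rewrite -[RHS](big_map (muln n) xpredT) -[LHS]big_filter.
apply: perm_big; apply: uniq_perm.
- by rewrite filter_uniq ?iota_uniq.
- by rewrite map_inj_uniq ?iota_uniq// => i j /eqP; rewrite eqn_pmul2l// => /eqP.
move=> k; rewrite mem_filter mem_index_iota ltnS.
apply/andP/mapP => [[/dvdnP[m ->]]|[m]].
  rewrite muln_gt0 => /andP[/andP[m0 _] mN].
  by exists m; rewrite 1?mulnC// mem_index_iota m0 ltnS leq_divRL// mulnC.
rewrite mem_index_iota ltnS leq_divRL// => /andP[m0 mN] ->.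
by rewrite dvdn_mulr// muln_gt0 n0 m0 mulnC.
Qed.

(** * The Moebius function and Moebius inversion *)

Lemma moebius_eq0 (p n : nat) : prime p -> (0 < n)%N -> (p ^ 2 %| n)%N ->
  moebius n = 0.
Proof.
move=> pp n0 pn; rewrite /moebius ifT//; apply/hasP; exists p => //.
by rewrite mem_primes pp n0 (dvdn_trans _ pn)// dvdn_exp.
Qed.

(** The factor [p] adds one prime to the list, which flips the sign, and creates no new square of a
    prime because [p] does not divide [n]. *)
Lemma moebius_prime_mul (p n : nat) : prime p -> (0 < n)%N -> ~~ (p %| n)%N ->
  moebius (p * n) = - moebius n.
Proof.
move=> pp n0 pn; have p0 := prime_gt0 pp.
have pnP : p \notin primes n by rewrite mem_primes pp n0.
have perm_pn : perm_eq (primes (p * n)) (p :: primes n).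
  apply: uniq_perm; rewrite /= ?pnP ?primes_uniq// => r.
  by rewrite primesM// primes_prime// !inE.
have sq : has (fun r => r ^ 2 %| p * n)%N (primes (p * n)) =
          has (fun r => r ^ 2 %| n)%N (primes n).
  rewrite (perm_has _ perm_pn) /= expnS expn1 dvdn_pmul2l// (negbTE pn) /=.
  apply: eq_in_has => r; rewrite mem_primes => /and3P[pr _ rn].
  rewrite Gauss_dvdr// coprimeXl// prime_coprime// dvdn_prime2//.
  by apply: contra pn => /eqP <-.
rewrite /moebius sq (perm_size perm_pn) /=; case: ifP => _; first by rewrite oppr0.
by rewrite exprS mulN1r.
Qed.

(* For a prime [p] dividing [n], the divisors prime to [p] cancel against their
   products by [p]; the remaining divisors are not squarefree. *)
Lemma sum_moebius (n : nat) : (0 < n)%N ->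
  \sum_(d <- divisors n) moebius d = (n == 1)%:R.
Proof.
move=> n0; have [->|n1] := eqVneq n 1%N; first by rewrite big_seq1.
have {n1}n1 : (1 < n)%N by rewrite ltn_neqAle eq_sym n1.
pose p := pdiv n; have pp : prime p := pdiv_prime n1; have p0 := prime_gt0 pp.
rewrite (bigID (dvdn p)) /= (bigID (dvdn (p ^ 2))) /= big1_seq ?add0r; last first.
  move=> d /andP[/andP[_ pd]]; rewrite -dvdn_divisors// => dn.
  by apply: (@moebius_eq0 p) => //; apply: dvdn_gt0 dn.
suff -> : \sum_(d <- divisors n | (p %| d)%N && ~~ (p ^ 2 %| d)%N) moebius d =
          \sum_(d <- divisors n | ~~ (p %| d)%N) moebius (p * d).
  rewrite -big_split big1_seq//= => d /andP[pd]; rewrite -dvdn_divisors// => dn.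
  by rewrite moebius_prime_mul ?addNr// (dvdn_gt0 n0 dn).
rewrite -[RHS]big_filter -[RHS](big_map (muln p) xpredT) -[LHS]big_filter.
apply: perm_big; apply: uniq_perm.
- by rewrite filter_uniq ?divisors_uniq.
- rewrite map_inj_uniq ?filter_uniq ?divisors_uniq// => i j /eqP.
  by rewrite eqn_pmul2l// => /eqP.
move=> k; rewrite mem_filter -dvdn_divisors//.
apply/idP/mapP => [/andP[/andP[/dvdnP[d ->]]]|[d]].
  rewrite expnS expn1 dvdn_pmul2r// => pd pdn; exists d; last by rewrite mulnC.
  by rewrite mem_filter pd -dvdn_divisors// (dvdn_trans _ pdn)// dvdn_mulr.
rewrite mem_filter -dvdn_divisors// => /andP[pd dn] ->.
rewrite dvdn_mulr//= expnS expn1 dvdn_pmul2l// pd /=.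
by rewrite Gauss_dvd ?pdiv_dvd// prime_coprime.
Qed.

Lemma divnK_codivisor (n d : nat) : (0 < n)%N -> (d %| n)%N ->
  (n %/ (n %/ d))%N = d.
Proof.
move=> n0 /dvdnP[m nE]; move: n0; rewrite nE muln_gt0 => /andP[m0 d0].
by rewrite mulnK// mulKn.
Qed.

Lemma sum_codivisors (V : nmodType) (F : nat -> V) (n : nat) : (0 < n)%N ->
  \sum_(d <- divisors n) F (n %/ d)%N = \sum_(d <- divisors n) F d.
Proof.
move=> n0; rewrite -[LHS](big_map (divn n) xpredT).
apply: perm_big; apply: uniq_perm; rewrite ?divisors_uniq//.
  rewrite map_inj_in_uniq ?divisors_uniq// => i j.
  rewrite -!dvdn_divisors// => ni nj e.
  by rewrite -(divnK_codivisor _ _ n0 ni) e divnK_codivisor.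
move=> k; rewrite -dvdn_divisors//; apply/mapP/idP => [[d]|kn].
  by rewrite -dvdn_divisors// => dn ->; apply: dvdn_div.
exists (n %/ k)%N; last by rewrite divnK_codivisor.
by rewrite -dvdn_divisors// dvdn_div.
Qed.

(** Writing [n = e * m] and [k = e * j] turns this into the sum of [moebius (j %/ m)] over the
    divisors [m] of [j], hence of [moebius] itself over them. The sum is empty when [e] does not
    divide [k]. *)
Lemma sum_moebius_between (e k N : nat) : (0 < e)%N -> (0 < k <= N)%N ->
  \sum_(1 <= n < N.+1 | (n %| k)%N && (e %| n)%N) moebius (k %/ n) =
  (k == e)%:R.
Proof.
move=> e0 /andP[k0 kN].
under eq_bigl do rewrite andbC.
rewrite big_mkcondr sum_multiples//.
have [/dvdnP[j kE]|ek] := boolP (e %| k)%N; last first.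
  have /negbTE -> : k != e by apply: contra ek => /eqP ->.
  apply: big1_seq => m _; case: ifPn => // /(dvdn_trans (dvdn_mulr m (dvdnn e))).
  by rewrite (negbTE ek).
have j0 : (0 < j)%N by move: k0; rewrite kE muln_gt0 => /andP[].
have -> : (k == e) = (j == 1)%N by rewrite kE -{2}[e]mul1n eqn_pmul2r.
rewrite -(sum_moebius j)// -sum_codivisors//.
rewrite (sum_divisors _ _ j (N %/ e)); last by rewrite j0 leq_divRL// -kE.
rewrite -big_mkcond; apply: congr_big_nat => // m _.
  by rewrite kE mulnC dvdn_pmul2r.
by rewrite kE [(e * m)%N]mulnC divnMr.
Qed.

(** Moebius inversion: once the sums are exchanged, the sum over [k] with [d | k | q] is that of
    [sum_moebius_between] and selects [d = q]. *)
Lemma sum_moebius_dirichlet_conv1 (K : pzRingType) (f : nat -> K) (q N : nat) :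
  (0 < q <= N)%N ->
  \sum_(1 <= k < N.+1 | (k %| q)%N)
    dirichlet_conv f (arith_one K) k * (moebius (q %/ k))%:~R = f q.
Proof.
move=> qN; have /andP[q0 qleN] := qN.
pose g k d := f d * (moebius (q %/ k))%:~R.
transitivity (\sum_(1 <= k < N.+1 | (k %| q)%N)
    \sum_(1 <= d < N.+1 | (d %| k)%N) g k d).
  rewrite big_nat_cond [RHS]big_nat_cond; apply: eq_bigr => k /andP[/andP[k0 kN] kq].
  rewrite /dirichlet_conv (sum_divisors _ _ _ N) ?k0// mulr_suml.
  by apply: eq_bigr => d _; rewrite /arith_one mulr1.
rewrite (exchange_big_dep_nat xpredT)//=.
transitivity (\sum_(1 <= d < N.+1) f d * (q == d)%:R).
  rewrite big_nat_cond [RHS]big_nat_cond; apply: eq_bigr => d /andP[/andP[d0 dN] _].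
  rewrite /g -mulr_sumr; congr (_ * _).
  by rewrite -rmorph_sum /= sum_moebius_between//; case: eqP.
rewrite (bigD1_seq q) ?iota_uniq ?mem_index_iota ?ltnS//= eqxx mulr1.
by rewrite big1 ?addr0// => d; rewrite eq_sym => /negbTE ->; rewrite mulr0.
Qed.

(** * Sums of roots of unity *)

(** The additive character exp(2 pi i x), given by its two components so that the real addition
    formulas apply. *)
Definition unit_exp (R : realType) (x : R) : R[i] :=
  cos (pi *+ 2 * x) +i* sin (pi *+ 2 * x).

Lemma unit_expD (R : realType) (x y : R) :
  unit_exp R (x + y) = unit_exp R x * unit_exp R y.
Proof.
rewrite /unit_exp mulrDr cosD sinD; apply/eqP; rewrite eq_complex /=.
by rewrite [X in _ && (_ == X)]addrC !eqxx.
Qed.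

Lemma unit_exp0 (R : realType) : unit_exp R 0 = 1.
Proof. by rewrite /unit_exp mulr0 cos0 sin0. Qed.

Lemma unit_expMn (R : realType) (x : R) (n : nat) :
  unit_exp R (x *+ n) = unit_exp R x ^+ n.
Proof.
elim: n => [|n IHn]; first by rewrite mulr0n unit_exp0 expr0.
by rewrite mulrS unit_expD IHn exprS.
Qed.

Lemma unit_exp_nat (R : realType) (n : nat) : unit_exp R n%:R = 1.
Proof. by rewrite unit_expMn /unit_exp mulr1 cos2pi sin2pi expr1n. Qed.

Lemma norm_unit_exp (R : realType) (x : R) : `|unit_exp R x| = 1.
Proof. by rewrite normc_def /= cos2Dsin2 sqrtr1. Qed.

(** Compare real parts: cos(2t) = 1 - 2 sin(t)^2 with [t = pi * x] strictly between 0 and [pi],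
    where the sine is positive. *)
Lemma unit_exp_neq1 (R : realType) (x : R) : 0 < x < 1 -> unit_exp R x != 1.
Proof.
move=> /andP[x0 x1]; apply/eqP => -[+ _].
rewrite mulrnAl cos_mulr2n => /eqP.
have /lt0r_neq0 : 0 < sin (pi * x).
  by rewrite sin_gt0_pi// mulr_gt0 ?pi_gt0//= gtr_pMr ?pi_gt0.
have -> : cos (pi * x) ^+ 2 = 1 - sin (pi * x) ^+ 2.
  by rewrite -(cos2Dsin2 (pi * x)) addrK.
rewrite subr_eq -[1 + 1]mulr2n -subr_eq0 -mulrnBl addrAC subrr sub0r.
by rewrite mulrn_eq0 /= oppr_eq0 sqrf_eq0 => /negP.
Qed.

(** The summands are powers of [w], an [r]-th root of unity that is 1 exactly when [r] divides [n];
    otherwise the geometric sum vanishes. *)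
Lemma sum_unit_exp (R : realType) (r n : nat) : (0 < r)%N ->
  \sum_(1 <= j < r.+1) unit_exp R ((j * n)%:R / r%:R) =
  if (r %| n)%N then r%:R else 0.
Proof.
move=> r0; have rR0 : r%:R != 0 :> R by rewrite pnatr_eq0 -lt0n.
pose w : R[i] := unit_exp R (n%:R / r%:R).
have wE j : unit_exp R ((j * n)%:R / r%:R) = w ^+ j.
  by rewrite -unit_expMn natrM -mulrA mulr_natl.
under eq_bigr do rewrite wE.
have [/dvdnP[a nE]|rn] := boolP (r %| n)%N.
  have -> : w = 1 by rewrite /w nE natrM mulfK// unit_exp_nat.
  by under eq_bigr do rewrite expr1n; rewrite sumr_const_nat subn1.
have w1 : w != 1.
  (* Only [n %% r] matters; it is nonzero, so its quotient by [r] lies strictly between 0 and 1. *)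
  rewrite /w {1}(divn_eq n r) natrD natrM mulrDl mulfK// unit_expD unit_exp_nat.
  rewrite mul1r unit_exp_neq1// divr_gt0 ?ltr0n//=; last by rewrite lt0n.
  by rewrite ltr_pdivrMr ?ltr0n// mul1r ltr_nat ltn_mod.
have wr : w ^+ r = 1 by rewrite -wE natrM mulrAC divff ?mul1r ?unit_exp_nat.
(* The sum starts at exponent 1, so one factor [w] is pulled out to leave the exponents 0 to
   [r - 1]. *)
rewrite big_add1 /= big_mkord; under eq_bigr do rewrite exprS.
rewrite -mulr_sumr; apply/eqP; rewrite mulf_eq0; apply/orP; right.
have := subrX1 w r; rewrite wr subrr => /esym/eqP.
by rewrite mulf_eq0 subr_eq0 (negbTE w1).
Qed.

(** * Ramanujan sums: bound, divisor formula, convolution with [moebius] *)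

Lemma ramanujan_sum_unit_exp (R : realType) (q n : nat) :
  ramanujan_sum R q n =
  \sum_(1 <= k < q.+1 | coprime k q) unit_exp R ((k * n)%:R / q%:R).
Proof.
apply: eq_bigr => k _; set x := (k * n)%:R / q%:R.
have -> : 2%:R * (pi : R)%:C * 'i%C * (k * n)%:R / q%:R =
          (pi *+ 2 * x)%:C * 'i%C :> R[i].
  rewrite /x; move: (k * n)%N => m.
  rewrite -[pi *+ 2]mulr_natl !rmorphM fmorphV !rmorph_nat /= !mulrA.
  by rewrite [RHS]mulrAC [X in _ = X * _]mulrAC.
rewrite /Cexp /unit_exp ReiNIm ImiRe /= oppr0 expR0.
by rewrite mul1r.
Qed.

Lemma norm_ramanujan_sum (R : realType) (q n : nat) :
  `|ramanujan_sum R q n| <= q%:R.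
Proof.
rewrite ramanujan_sum_unit_exp (le_trans (ler_norm_sum _ _ _))//.
under eq_bigr do rewrite norm_unit_exp.
rewrite big_mkcond (@le_trans _ _ (\sum_(1 <= k < q.+1) 1))//.
  by apply: ler_sum => k _; case: ifP.
by rewrite sumr_const_nat subn1.
Qed.

(** The common divisors of [k] and [q] are the divisors of their gcd. This expands the coprimality
    condition of the Ramanujan sum. *)
Lemma coprime_sum_moebius (k q : nat) : (0 < k)%N -> (0 < q)%N ->
  \sum_(1 <= d < q.+1 | (d %| q)%N && (d %| k)%N) moebius d =
  (coprime k q)%:R.
Proof.
move=> k0 q0; rewrite /coprime -sum_moebius ?gcdn_gt0 ?k0//.
rewrite (sum_divisors _ _ _ q); last first.
  by rewrite gcdn_gt0 k0 /= dvdn_leq ?dvdn_gcdr.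
by apply: eq_bigl => d; rewrite dvdn_gcd andbC.
Qed.

(** After coprimality is expanded, each [d] dividing [q] contributes a complete sum of roots of
    unity modulo [q %/ d]; finally [d] and [q %/ d] trade places. *)
Lemma ramanujan_sum_divisors (R : realType) (q n : nat) : (0 < q)%N ->
  ramanujan_sum R q n =
  \sum_(1 <= d < q.+1 | (d %| q)%N && (d %| n)%N)
    (moebius (q %/ d))%:~R * d%:R.
Proof.
move=> q0; rewrite ramanujan_sum_unit_exp big_mkcond /=.
pose E k : R[i] := unit_exp R ((k * n)%:R / q%:R).
pose F r : R[i] := if (r %| n)%N then r%:R else 0.
transitivity (\sum_(1 <= k < q.+1)
    \sum_(1 <= d < q.+1 | (d %| q)%N && (d %| k)%N) (moebius d)%:~R * E k).
  rewrite big_nat [RHS]big_nat; apply: eq_bigr => k /andP[k0 _].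
  rewrite -mulr_suml -rmorph_sum /= coprime_sum_moebius//.
  by case: ifP => _; rewrite ?mul1r ?mul0r.
rewrite (exchange_big_dep_nat (fun d => d %| q)%N) /=; last first.
  by move=> i j _ _ _ /andP[].
transitivity (\sum_(1 <= d < q.+1 | (d %| q)%N) (moebius d)%:~R * F (q %/ d)%N).
  apply: eq_bigr => d dq; rewrite -mulr_sumr; congr (_ * _).
  have d0 := dvdn_gt0 q0 dq; under eq_bigl do rewrite dq.
  rewrite sum_multiples// /F -(sum_unit_exp R (q %/ d) n); last first.
    by rewrite divn_gt0// dvdn_leq.
  (* With [k = d * m], the phase [k * n / q] equals [m * n / (q %/ d)]. *)
  apply: eq_bigr => m _; rewrite /E -mulnA; move: (m * n)%N => j.
  rewrite -{1}(divnK dq) [(q %/ d * d)%N]mulnC; move: (q %/ d)%N => r.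
  by rewrite !natrM -mulf_div divff ?mul1r// pnatr_eq0 -lt0n.
rewrite -sum_divisors ?q0 ?leqnn//.
rewrite -(sum_codivisors _ (fun d => (moebius d)%:~R * F (q %/ d)%N)) => //.
rewrite (sum_divisors _ _ _ q) ?q0 ?leqnn//= big_mkcondr /=.
apply: eq_bigr => d dq; rewrite divnK_codivisor// /F.
by case: ifP => // _; rewrite mulr0.
Qed.

(** With the divisor formula inserted, the sum over [n] with [d | n | k] leaves only [d = k], a term
    present only if [k] divides [q]. *)
Lemma ramanujan_sum_conv_moebius (R : realType) (q k N : nat) :
  (0 < q)%N -> (0 < k <= N)%N ->
  \sum_(1 <= n < N.+1 | (n %| k)%N) ramanujan_sum R q n * (moebius (k %/ n))%:~R =
  if (k %| q)%N then (moebius (q %/ k))%:~R * k%:R else 0.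
Proof.
move=> q0 kN.
under eq_bigr do rewrite ramanujan_sum_divisors// mulr_suml.
rewrite (exchange_big_dep_nat (fun d => d %| q)%N) /=; last first.
  by move=> i j _ _ _ /andP[].
transitivity (\sum_(1 <= d < q.+1 | (d %| q)%N)
   (if d == k then (moebius (q %/ k))%:~R * k%:R else 0) : R[i]).
  rewrite big_nat_cond [RHS]big_nat_cond; apply: eq_bigr => d /andP[/andP[d0 _] dq].
  under eq_bigl do rewrite dq.
  rewrite -mulr_sumr -rmorph_sum /= sum_moebius_between// eq_sym.
  by case: eqP => [->|_]; rewrite ?mulr1 ?mulr0.
rewrite -big_mkcondr /= big_mkcond; case: ifPn => kq; last first.
  by rewrite big1// => d _; case: ifP => // /andP[dq /eqP dk]; rewrite -dk dq in kq.
have /andP[k0 _] := kN.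
have kin : k \in index_iota 1 q.+1 by rewrite mem_index_iota k0 ltnS dvdn_leq.
rewrite (bigD1_seq k kin (iota_uniq _ _)) kq eqxx /=.
by rewrite big1 ?addr0// => d /negbTE ->; rewrite andbF.
Qed.

(** * Bounds and convergence in the complex numbers *)

Lemma norm_moebius_le1 (K : numDomainType) (n : nat) :
  `|(moebius n)%:~R : K| <= 1.
Proof.
rewrite /moebius; case: ifP => _; first by rewrite normr0 ler01.
by rewrite rmorphXn rmorphN1 normrX normrN1 expr1n.
Qed.

(** In the order of [R[i]], comparability with 0 forces a zero imaginary part; complex-typed radii
    thus become real ones. *)
Lemma gtc0_real (R : rcfType) (z : R[i]) : 0 < z ->
  exists2 x : R, 0 < x & z = x%:C.
Proof.
move=> z0; have /complex_realP[x zE] : z \is Num.real by exact: gtr0_real.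
by exists x => //; rewrite -ltcR -zE.
Qed.

Lemma cvgn_complex (R : realType) (u : nat -> R[i]^o) (a b : R) :
  (complex.Re (u n) @[n --> \oo] --> a)%classic ->
  (complex.Im (u n) @[n --> \oo] --> b)%classic ->
  (u n @[n --> \oo] --> (a +i* b : R[i]^o))%classic.
Proof.
move=> ua ub; apply/cvgrPdist_lt => eps eps0.
have [e e0 epsE] := gtc0_real R eps eps0.
have e20 : 0 < e / 2 by rewrite divr_gt0.
move/cvgrPdist_lt : ua => /(_ _ e20) ua; move/cvgrPdist_lt : ub => /(_ _ e20) ub.
near=> n.
have -> : (a +i* b : R[i]^o) - u n =
    (a - complex.Re (u n))%:C + (b - complex.Im (u n))%:C * 'i%C :> R[i].
  by case: (u n) => x y; simpc.
rewrite (le_lt_trans (ler_normD _ _))// normrM epsE !normc_def /=.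
rewrite !expr0n expr1n /= !addr0 add0r sqrtr1 mulr1 !sqrtr_sqr -rmorphD ltcR.
rewrite [e]splitr ltrD//; by [near: n; exact: ua | near: n; exact: ub].
Unshelve. all: by end_near. Qed.

Lemma is_cvgn_bounded_abs_sums (R : realType) (u : nat -> R) (L : R) :
  (forall N, \sum_(1 <= k < N.+1) `|u k| <= L) ->
  cvgn (fun N => \sum_(1 <= k < N.+1) u k).
Proof.
move=> uL; have -> : (fun N => \sum_(1 <= k < N.+1) u k) = series (u \o S).
  by apply/funext => N; rewrite big_add1.
apply: normed_cvg; apply: nondecreasing_is_cvgn.
  by apply/nondecreasing_seqP => n; rewrite /series /= [leRHS]big_nat_recr//= lerDl.
by exists L => _ [N _ <-]; have := uL N; rewrite big_add1.
Qed.

(** Absolute convergence passes to the real and imaginary parts, each dominated by the modulus. *)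
Lemma is_cvgn_partial_sums (R : realType) (u : nat -> R[i]) (L : R) :
  (forall N, \sum_(1 <= k < N.+1) `|u k| <= L%:C) -> cvgn (partial_sums u).
Proof.
move=> uL.
have bound (p : R[i] -> R) : (forall z, `|p z|%:C <= `|z|) ->
    cvgn (fun N => \sum_(1 <= k < N.+1) p (u k)).
  move=> p_le; apply: (@is_cvgn_bounded_abs_sums _ _ L) => N.
  rewrite -lecR rmorph_sum; apply: le_trans (uL N).
  by apply: ler_sum => k _; exact: p_le.
have ReD : {morph @complex.Re R : x y / x + y} by case=> ? ? [].
have ImD : {morph @complex.Im R : x y / x + y} by case=> ? ? [].
have /cvg_ex[a ha] := bound _ (@normc_ge_Re R).
have /cvg_ex[b hb] : cvgn (fun N => \sum_(1 <= k < N.+1) complex.Im (u k)).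
  apply: bound => -[x y]; rewrite normc_def lecR /= -sqrtr_sqr ler_wsqrtr//.
  by rewrite lerDr sqr_ge0.
apply: (cvgP (a +i* b : R[i]^o)); apply: cvgn_complex.
  under eq_cvg do rewrite /partial_sums (big_morph (@complex.Re R) ReD erefl).
  exact: ha.
under eq_cvg do rewrite /partial_sums (big_morph (@complex.Im R) ImD erefl).
exact: hb.
Qed.

Lemma cvgn_norm_le (K : numFieldType) (u : nat -> K^o) (z B : K) :
  (u n @[n --> \oo] --> (z : K^o))%classic ->
  (\forall n \near \oo%classic, `|u n| <= B) -> `|z| <= B.
Proof.
move=> uz uB.
(* The order on [K] may be partial: a norm below [B] makes [B] nonnegative, hence comparable with
   the norm of [z]. *)
have [n0 hn0] := filter_ex uB; have B0 : 0 <= B by apply: le_trans hn0.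
rewrite real_leNgt ?ger0_real//; apply/negP => Bz.
move/cvgrPdist_lt : uz => /(_ (`|z| - B)); rewrite subr_gt0 => /(_ Bz) uz.
have [n [zn nB]] := filter_ex (filterI uz uB).
have := le_lt_trans (ler_normD (z - u n) (u n)) (ltr_leD zn nB).
by rewrite !subrK ltxx.
Qed.

(** The partial sums increase and stay below the finite extended sum, so they converge, and their
    limit dominates them. *)
Lemma nonneg_series_cvg (R : realType) (w : nat -> R) : (forall k, 0 <= w k) ->
  (\sum_(1 <= k <oo) (w k)%:E < +oo)%E ->
  exists2 L : R, forall N, \sum_(1 <= k < N.+1) w k <= L &
    (\sum_(1 <= k < N.+1) w k @[N --> \oo] --> L)%classic.
Proof.
move=> w0 wfin; pose W N := \sum_(1 <= k < N.+1) w k.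
have Wmono : {homo W : n m / (n <= m)%N >-> n <= m}.
  by apply/nondecreasing_seqP => n; rewrite /W [leRHS]big_nat_recr//= lerDl.
have sum_ge0 : (0 <= \sum_(1 <= k <oo) (w k)%:E)%E.
  by apply: nneseries_ge0 => k _ _; rewrite lee_fin.
have Wcvg : cvgn W.
  apply: nondecreasing_is_cvgn => //.
  exists (fine (\sum_(1 <= k <oo) (w k)%:E)%E) => _ [N _ <-].
  rewrite -lee_fin fineK ?ge0_fin_numE// /W -sumEFin.
  by apply: nneseries_lim_ge => k _ _; rewrite lee_fin.
exists (limn W) => // N; exact: (nondecreasing_cvgn_le Wmono Wcvg N).
Qed.

(** * The truncated double sum and its error *)

(** The function called [h] in the outline above. *)
Definition conv1_quot (R : realType) (f : nat -> R[i]) (k : nat) : R[i] :=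
  dirichlet_conv f (arith_one R[i]) k / k%:R.

(** Cutting [m] at [M %/ n] amounts to cutting [k = n * m] at [M], so all [n] share one range of [k]
    and the exchange involves finite sums only. *)
Lemma dual_RF_coef_term_partial (R : realType) (f : nat -> R[i]) (n M : nat) :
  (0 < n)%N ->
  partial_sums (dual_RF_coef_term f n) (M %/ n) =
  \sum_(1 <= k < M.+1 | (n %| k)%N) conv1_quot R f k * (moebius (k %/ n))%:~R.
Proof.
by move=> n0; rewrite sum_multiples//; apply: eq_bigr => m _; rewrite mulKn.
Qed.

Lemma count_divisors_le_tau (k N : nat) : (0 < k)%N -> (N <= k)%N ->
  (\sum_(1 <= n < N.+1 | n %| k) 1 <= tau k)%N.
Proof.
move=> k0 Nk; rewrite /tau -sum1_size [leqRHS](sum_divisors _ (fun=> 1%N) k k) ?k0 ?leqnn//.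
by rewrite [leqRHS](big_cat_nat _ (n := N.+1))//= leq_addr.
Qed.

(* Only the [k <= N] contribute the complete convolution of [ramanujan_sum q]
   with [moebius]; it vanishes unless [k] divides [q], and Moebius inversion
   then yields [f q]. *)
Lemma norm_truncated_expansion (R : realType) (f : nat -> R[i]) (q N M : nat) :
  (0 < q <= N)%N -> (N <= M)%N ->
  `|\sum_(1 <= n < N.+1)
      partial_sums (dual_RF_coef_term f n) (M %/ n) * ramanujan_sum R q n - f q|
  <= q%:R * \sum_(N.+1 <= k < M.+1) `|conv1_quot R f k| * (tau k)%:R.
Proof.
move=> qN NM; have /andP[q0 _] := qN.
pose G k := \sum_(1 <= n < N.+1 | (n %| k)%N)
  ramanujan_sum R q n * (moebius (k %/ n))%:~R.
have -> : \sum_(1 <= n < N.+1)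
      partial_sums (dual_RF_coef_term f n) (M %/ n) * ramanujan_sum R q n =
    \sum_(1 <= k < M.+1) conv1_quot R f k * G k.
  transitivity (\sum_(1 <= n < N.+1) \sum_(1 <= k < M.+1 | (n %| k)%N)
      conv1_quot R f k * (ramanujan_sum R q n * (moebius (k %/ n))%:~R)).
    rewrite [LHS]big_nat [RHS]big_nat; apply: eq_bigr => n /andP[n0 _].
    rewrite dual_RF_coef_term_partial// mulr_suml; apply: eq_bigr => k _.
    by rewrite mulrAC mulrA.
  rewrite (exchange_big_dep_nat xpredT)//=.
  by apply: eq_bigr => k _; rewrite mulr_sumr.
rewrite (big_cat_nat _ (n := N.+1))//=.
have -> : \sum_(1 <= k < N.+1) conv1_quot R f k * G k = f q.
  rewrite -(sum_moebius_dirichlet_conv1 _ f q N)// [RHS]big_mkcond.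
  rewrite [LHS]big_nat [RHS]big_nat; apply: eq_bigr => k /andP[k0 kN].
  rewrite /G ramanujan_sum_conv_moebius ?k0//.
  case: ifP => _; last by rewrite mulr0.
  rewrite [X in _ * X]mulrC mulrA /conv1_quot divfK//.
  by rewrite pnatr_eq0 -lt0n.
rewrite addrAC subrr add0r mulr_sumr (le_trans (ler_norm_sum _ _ _))//.
rewrite [leLHS]big_nat [leRHS]big_nat; apply: ler_sum => k /andP[Nk _].
rewrite normrM mulrCA ler_wpM2l// /G (le_trans (ler_norm_sum _ _ _))//.
apply: (@le_trans _ _ (\sum_(1 <= n < N.+1 | (n %| k)%N) q%:R)).
  apply: ler_sum => n _; rewrite normrM -[leRHS]mulr1.
  by rewrite ler_pM// ?norm_ramanujan_sum ?norm_moebius_le1.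
have k0 : (0 < k)%N by apply: leq_trans Nk.
rewrite [leRHS]mulr_natr (eq_bigr (fun=> q%:R *+ 1)) => [|//].
by rewrite sumrMnr ler_wpMn2l ?ler0n// count_divisors_le_tau// ltnW.
Qed.

(** * Convergence of the coefficients and passage to the limit *)

Theorem theorem3p4 (R : realType) (f : nat -> R[i])
  (hf : (\sum_(1 <= q <oo)
           (ComplexField.Normc.normc (dirichlet_conv f (arith_one R[i]) q)
              / q%:R * (tau q)%:R)%:E < +oo)%E) :
  (forall n : nat, (0 < n)%N -> cvgn (partial_sums (dual_RF_coef_term f n))) /\
  (forall q : nat, (0 < q)%N ->
     let s := partial_sums (fun n => dual_RF_coef f n * ramanujan_sum R q n) in
     cvgn s /\ f q = limn s).
Proof.
pose w q := ComplexField.Normc.normc (dirichlet_conv f (arith_one R[i]) q)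
              / q%:R * (tau q)%:R.
(* The hypothesis uses the real-valued modulus, the lemmas above the norm with values in [R[i]]. *)
have normcC z : (ComplexField.Normc.normc z : R)%:C = `|z| by [].
have w0 k : 0 <= w k.
  by rewrite /w !mulr_ge0 ?invr_ge0 ?ler0n// -(lecR 0) normcC normr_ge0.
have wE k : (w k)%:C = `|conv1_quot R f k| * (tau k)%:R.
  by rewrite /w /conv1_quot !rmorphM fmorphV !rmorph_nat /= normcC normrM normfV normr_nat.
have [L WL Wcvg] := nonneg_series_cvg _ _ w0 hf.
have coef_cvg n : (0 < n)%N -> cvgn (partial_sums (dual_RF_coef_term f n)).
  move=> n0; apply: (is_cvgn_partial_sums _ _ L) => N.
  (* Each term is dominated by [w (n * m)], since the Moebius factor has norm at most 1 and the
     divisor 1 gives [1 <= tau (n * m)]. *)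
  apply: (@le_trans _ _ (\sum_(1 <= m < N.+1) (w (n * m)%N)%:C)).
    rewrite [leLHS]big_nat [leRHS]big_nat; apply: ler_sum => m /andP[m0 _].
    rewrite wE normrM ler_wpM2l// (le_trans (norm_moebius_le1 _ _))// ler1n.
    have := count_divisors_le_tau (n * m) 1; rewrite muln_gt0 n0 m0 => /(_ isT isT).
    by rewrite big_mkcond big_nat1 dvd1n.
  (* The indices [n * m] are the multiples of [n] up to [n * N], so this is a subsum of a sum
     bounded by [L]. *)
  rewrite -{1}(mulKn N n0) -(sum_multiples _ (fun k => (w k)%:C))//.
  apply: le_trans (_ : (\sum_(1 <= k < (n * N).+1) w k)%:C <= _); last by rewrite lecR.
  rewrite rmorph_sum big_mkcond /=; apply: ler_sum => k _.
  by case: ifP => // _; rewrite lecR.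
split=> // q q0 s.
(* Here [N] is fixed and [M] tends to infinity, as does [M %/ n]: the truncated inner sums tend to
   the coefficients, and the error stays below [q] times the tail of [w] beyond [N]. *)
have sbound N : (q <= N)%N ->
    `|s N - f q| <= q%:R * (L - \sum_(1 <= k < N.+1) w k)%:C.
  move=> qN.
  apply: (@cvgn_norm_le _ (fun M => \sum_(1 <= n < N.+1)
      partial_sums (dual_RF_coef_term f n) (M %/ n) * ramanujan_sum R q n - f q)).
    apply: cvgB; last exact: cvg_cst.
    rewrite /s /partial_sums big_nat_cond; under eq_cvg do rewrite big_nat_cond.
    apply: cvg_big => [|n /andP[/andP[n0 _] _]]; first exact: add_continuous.
    apply: cvgMr_tmp; apply: cvg_comp (coef_cvg n n0).
    exact: cvg_divnr.
  near=> M.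
  have NM : (N <= M)%N by near: M; exact: nbhs_infty_ge.
  apply: le_trans (norm_truncated_expansion _ _ _ _ _ _ NM) _; first by rewrite q0.
  rewrite ler_wpM2l// (eq_bigr (fun k => (w k)%:C)) => [|k _]; last by rewrite wE.
  by rewrite -rmorph_sum lecR lerBrDl -big_cat_nat//=.
have scvg : (s N @[N --> \oo] --> (f q : R[i]^o))%classic.
  apply/cvgrPdist_lt => eps eps0.
  have [e e0 epsE] := gtc0_real R eps eps0.
  (* Dividing by [q] absorbs the factor [q] in [sbound]. *)
  have eq0 : 0 < e / q%:R by rewrite divr_gt0 ?ltr0n.
  move/cvgrPdist_lt : Wcvg => /(_ _ eq0) Wcvg.
  near=> N.
  rewrite distrC (le_lt_trans (sbound N _))//; first by near: N; exact: nbhs_infty_ge.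
  rewrite epsE -(rmorph_nat (real_complex R)) -rmorphM ltcR mulrC -ltr_pdivlMr ?ltr0n//.
  by rewrite (le_lt_trans (ler_norm _))//; near: N; exact: Wcvg.
by split; [exact: cvgP scvg | rewrite (cvg_lim _ scvg)].
Unshelve. all: by end_near. Qed.
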